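(* Let $t>1$ be fixed, let $k$ be a positive integer with $k<n_1$ and $tk<n_1$, let $\lambda>0$ and $\epsilon\ge 0$, and let $\mathcal{A}:\mathbb{R}^{n_1\times n_2}\to\mathbb{R}^m$ be a linear measurement map whose restricted isometry constant of order $tk$ satisfies $$\delta_{tk}<\sqrt{\frac{t-1}{t}}.$$ Put $$\beta_1=\frac{2}{(1-\delta_{tk})\sqrt{1+\delta_{tk}}},\qquad \beta_2=\frac{\delta_{tk}}{\sqrt{(1-(\delta_{tk})^2)(t-1)}}.$$ Then for every $X\in\mathbb{R}^{n_1\times n_2}$, every $\bm{n}\in\mathbb{R}^m$ with $\|\bm{n}\|_2\le\epsilon$, and $\bm{b}=\mathcal{A}(X)+\bm{n}$, any optimal solution $X^{\sharp}$ of $$\min_{Y\in\mathbb{R}^{n_1\times n_2}}\ \|Y\|_*+\frac{1}{2\lambda}\|\bm{b}-\mathcal{A}(Y)\|_2^2$$ satisfies $$\|\mathcal{A}(X^{\sharp}-X)\|_2\le C_1\|X-X_{[k]}\|_*+C_2,$$ $$\|X^{\sharp}-X\|_F\le C_3\|X-X_{[k]}\|_*+C_4,$$ where $$C_1=\frac{2\lambda}{\sqrt{k}\beta_1\lambda+\epsilon},\qquad C_2=2\left(\sqrt{k}\beta_1\lambda+\epsilon\right),$$ $$C_3=\frac{2\sqrt{k}\beta_1[3+3\beta_2+(\beta_2)^2]\lambda+2[1+4\beta_2+2(\beta_2)^2]\epsilon}{\sqrt{k}(1-\beta_2)(\sqrt{k}\beta_1\lambda+\epsilon)},$$ $$C_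4=\frac{\sqrt{k}\beta_1(5+2\beta_2)\lambda+[1+4\beta_2+2(\beta_2)^2]\epsilon}{\sqrt{k}(1-\beta_2)\lambda}\left(\sqrt{k}\beta_1\lambda+\epsilon\right).$$
   Context: Throughout $n_1\le n_2$. A linear measurement map is $\mathcal{A}(X)=[\mathrm{tr}(X^TA^{(1)}),\dots,\mathrm{tr}(X^TA^{(m)})]^T$ with fixed matrices $A^{(i)}\in\mathbb{R}^{n_1\times n_2}$. $\|\cdot\|_*$ is the nuclear norm (sum of singular values), $\|\cdot\|_F$ the Frobenius norm, $\|\cdot\|_2$ the Euclidean norm. For a matrix $X$ with singular value decomposition $X=\sum_{i=1}^{n_1}\sigma_i\bm{a}^{(i)}(\bm{c}^{(i)})^T$, $\sigma_1\ge\sigma_2\ge\dots\ge\sigma_{n_1}\ge0$, $X_{[k]}=\sum_{i=1}^k\sigma_i\bm{a}^{(i)}(\bm{c}^{(i)})^T$ denotes its best rank-$k$ approximation. ''Rank-$k$ matrix'' means a matrix of rank at most $k$. Restricted isometry constant: for a positive integer $k$, $\mathcal{A}$ satisfies the restricted isometry property (RIP) of order $k$ with restricted isometry constant $\delta_k$ if $\delta_k$ is the smallest $\delta\in(0,1)$ such that $(1-\delta)\|X\|_F^2\le\|\mathcal{A}(X)\|_2^2\le(1+\delta)\|X\|_F^2$ for every rank-$k$ matrix $X\in\mathbb{R}^{n_1\times n_2}$. For non-integer order $s$, $\delta_s:=\delta_{\lceil s\rceil}$. *)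

(* Defs.v *)
From mathcomp Require Import all_boot all_order all_algebra.
From mathcomp Require Import all_classical all_reals.

Set Implicit Arguments.
Unset Strict Implicit.
Unset Printing Implicit Defensive.

Import Order.TTheory GRing.Theory Num.Theory.
Local Open Scope ring_scope.
Local Open Scope classical_set_scope.

Definition l2norm (R : realType) (m : nat) (v : 'cV[R]_m) : R :=
  Num.sqrt (\sum_i v i 0 ^+ 2).

Definition frobenius (R : realType) (n1 n2 : nat) (X : 'M[R]_(n1, n2)) : R :=
  Num.sqrt (\sum_i \sum_j X i j ^+ 2).

(* The measurement map X |-> (tr (X^T A^(i)))_i given by the matrices A^(i). *)
Definition measure_map (R : realType) (n1 n2 m : nat)
    (A : 'I_m -> 'M[R]_(n1, n2)) (X : 'M[R]_(n1, n2)) : 'cV[R]_m :=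
  \col_i \tr (X^T *m A i).

(* The sum of the first k rank-one terms s_i a^(i) (c^(i))^T, where a^(i) and
   c^(i) are the i-th columns of U and V; indices start at 0. *)
Definition svd_trunc (R : realType) (n1 n2 : nat) (k : nat)
    (s : 'rV[R]_n1) (U : 'M[R]_n1) (V : 'M[R]_(n2, n1)) : 'M[R]_(n1, n2) :=
  \sum_(i < n1 | (i < k)%N) s 0 i *: (col i U *m (col i V)^T).

(* (s, U, V) is a singular value decomposition of X, with n1 singular values
   (so that one exists for every X exactly when n1 <= n2). *)
Definition is_svd (R : realType) (n1 n2 : nat) (X : 'M[R]_(n1, n2))
    (s : 'rV[R]_n1) (U : 'M[R]_n1) (V : 'M[R]_(n2, n1)) : Prop :=
  [/\ U^T *m U = 1%:M,
      V^T *m V = 1%:M,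
      forall i, 0 <= s 0 i,
      forall i j : 'I_n1, (i <= j)%N -> s 0 j <= s 0 i
    & X = svd_trunc n1 s U V].

(* Meaningful for n1 <= n2; the vector is then uniquely determined by X. *)
Definition singular_values (R : realType) (n1 n2 : nat)
    (X : 'M[R]_(n1, n2)) : 'rV[R]_n1 :=
  xget 0 [set s | exists U V, is_svd X s U V].

Definition nuclear (R : realType) (n1 n2 : nat) (X : 'M[R]_(n1, n2)) : R :=
  \sum_i singular_values X 0 i.

Definition rip_bounds (R : realType) (n1 n2 m : nat)
    (A : 'I_m -> 'M[R]_(n1, n2)) (k : nat) (delta : R) : Prop :=
  forall X : 'M[R]_(n1, n2), (\rank X <= k)%N ->
    (1 - delta) * frobenius X ^+ 2 <= l2norm (measure_map A X) ^+ 2 /\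
    l2norm (measure_map A X) ^+ 2 <= (1 + delta) * frobenius X ^+ 2.

(* The minimum is over the open interval ]0, 1[, so a map that is exactly
   isometric on matrices of rank at most k has no constant of order k. *)
Definition is_ric (R : realType) (n1 n2 m : nat)
    (A : 'I_m -> 'M[R]_(n1, n2)) (k : nat) (delta : R) : Prop :=
  [/\ 0 < delta < 1,
      rip_bounds A k delta
    & forall d : R, 0 < d < 1 -> rip_bounds A k d -> delta <= d].

(* For s > 0 the integer Num.ceil s is positive, so `|_|%N is only a cast. *)
Definition is_ric_real (R : realType) (n1 n2 m : nat)
    (A : 'I_m -> 'M[R]_(n1, n2)) (s : R) (delta : R) : Prop :=
  is_ric A `|Num.ceil s|%N delta.

Definition objective (R : realType) (n1 n2 m : nat)
    (A : 'I_m -> 'M[R]_(n1, n2)) (lambda : R) (b : 'cV[R]_m)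
    (Y : 'M[R]_(n1, n2)) : R :=
  nuclear Y + (2 * lambda)^-1 * l2norm (b - measure_map A Y) ^+ 2.

Definition is_optimal (R : realType) (n1 n2 m : nat)
    (A : 'I_m -> 'M[R]_(n1, n2)) (lambda : R) (b : 'cV[R]_m)
    (Xs : 'M[R]_(n1, n2)) : Prop :=
  forall Y : 'M[R]_(n1, n2), objective A lambda b Xs <= objective A lambda b Y.

(* Main.v *)
Require Import Defs.
From mathcomp Require Import all_boot all_order all_algebra.
From mathcomp Require Import all_classical all_reals.
From mathcomp Require topology normedtype derive.
From mathcomp Require Import finset.
From mathcomp Require Import ring lra.

(** Write H = Xs - X, let h be its vector of singular values, x the l2 norm of
    the k largest of them, T the sum of the others, P = |A H|, and rho the sum
    of the singular values of X beyond the k-th.  Three facts give the bounds.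

    - Optimality of Xs against X says that P^2 - 2 eps P is at most
      2 lambda (nuclear X - nuclear (X + H)).  By [nuclear_add_ge] the last
      bracket is at most 2 rho + (h_1 + ... + h_k) - T.  This is the special
      case of Mirsky's inequality sum_i |s_i(X) - s_i(H)| <= nuclear (X + H)
      that is needed.  It is proved by exhibiting one dual certificate (a matrix
      with orthonormal rows, see [nuclear_ge]): start from W0 = UH VH^T, whose
      inner product with H is nuclear H, and multiply it by an orthogonal Q, a
      product of at most k reflections, chosen so that W0 Q takes the value 1 on
      each of the k leading singular pairs of X ([orth_extension]).  As 1 - Q
      lives on a space of dimension at most k, its compression to the right
      singular vectors of H has diagonal entries in [0, 2] of total at most 2k,
      so that passing from W0 to W0 Q costs at most 2 (h_1 + ... + h_k).

    - The isometry property of order N = ceil (t k) gives the robust null space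
      inequality x <= beta1 P + beta2 T / sqrt k ([robust_nsp]).  With q = N - k,
      keep in w the k leading singular components of H and those larger than
      T / q; the remaining coefficients form a point of a polytope on which the
      linear form v |-> - <A w, A v> is dominated by its value at a
      sparse vertex ([sparse_dominates]).  That vertex and w together involve at
      most N singular pairs, and applying the isometry bounds to two well-chosen
      combinations of them bounds the form ([rip_cross]).

    - As the discarded singular values are at most x / sqrt k, the Frobenius
      norm of H is at most x + T / (2 sqrt k) ([sqrt_sum_le]).

    Eliminating x and T leaves the quadratic inequality
    P^2 - 2 c P <= 4 lambda rho with c = sqrt k beta1 lambda + eps
    ([error_bounds]).

    Singular value decompositions are obtained by successive maximisation of
    the bilinear form of the matrix ([svd_exists]); duality shows that
    [nuclear] is the sum of the singular values in any of them
    ([nuclear_svd]). *)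

Set Implicit Arguments.
Unset Strict Implicit.
Unset Printing Implicit Defensive.

Import Order.TTheory GRing.Theory Num.Theory.
Local Open Scope ring_scope.

(** * The trace inner product of matrices *)

Definition ip (R : realType) (p q : nat) (A B : 'M[R]_(p, q)) : R :=
  \tr (A^T *m B).

Section InnerProduct.
Context {R : realType}.

Lemma ipE p q (A B : 'M[R]_(p, q)) : ip A B = \sum_i \sum_j A i j * B i j.
Proof.
rewrite /ip /mxtrace exchange_big /=; apply: eq_bigr => j _.
by rewrite mxE; apply: eq_bigr => i _; rewrite mxE.
Qed.

Lemma ipC p q (A B : 'M[R]_(p, q)) : ip A B = ip B A.
Proof. by rewrite /ip -mxtrace_tr trmx_mul trmxK. Qed.

Lemma ipDr p q (A B C : 'M[R]_(p, q)) : ip A (B + C) = ip A B + ip A C.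
Proof. by rewrite /ip mulmxDr mxtraceD. Qed.

Lemma ipZr p q a (A B : 'M[R]_(p, q)) : ip A (a *: B) = a * ip A B.
Proof. by rewrite /ip -scalemxAr mxtraceZ. Qed.

Lemma ipNr p q (A B : 'M[R]_(p, q)) : ip A (- B) = - ip A B.
Proof. by rewrite -scaleN1r ipZr mulN1r. Qed.

Lemma ipBr p q (A B C : 'M[R]_(p, q)) : ip A (B - C) = ip A B - ip A C.
Proof. by rewrite ipDr ipNr. Qed.

Lemma ip0r p q (A : 'M[R]_(p, q)) : ip A 0 = 0.
Proof. by rewrite /ip mulmx0 mxtrace0. Qed.

Lemma ipDl p q (A B C : 'M[R]_(p, q)) : ip (B + C) A = ip B A + ip C A.
Proof. by rewrite ipC ipDr !(ipC A). Qed.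

Lemma ipZl p q a (A B : 'M[R]_(p, q)) : ip (a *: B) A = a * ip B A.
Proof. by rewrite ipC ipZr (ipC A). Qed.

Lemma ipNl p q (A B : 'M[R]_(p, q)) : ip (- B) A = - ip B A.
Proof. by rewrite ipC ipNr (ipC A). Qed.

Lemma ipBl p q (A B C : 'M[R]_(p, q)) : ip (B - C) A = ip B A - ip C A.
Proof. by rewrite ipDl ipNl. Qed.

Lemma ip0l p q (A : 'M[R]_(p, q)) : ip 0 A = 0.
Proof. by rewrite ipC ip0r. Qed.

Lemma ip_sumr p q (I : finType) (P : pred I) (A : 'M[R]_(p, q))
    (F : I -> 'M[R]_(p, q)) :
  ip A (\sum_(i | P i) F i) = \sum_(i | P i) ip A (F i).
Proof. by rewrite /ip mulmx_sumr raddf_sum. Qed.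

Lemma ip_mull p q r (W : 'M[R]_(p, r)) (A : 'M[R]_(r, q)) (B : 'M[R]_(p, q)) :
  ip (W *m A) B = ip A (W^T *m B).
Proof. by rewrite /ip trmx_mul mulmxA. Qed.

Lemma ip_mulr p q r (W : 'M[R]_(r, q)) (A : 'M[R]_(p, r)) (B : 'M[R]_(p, q)) :
  ip (A *m W) B = ip A (B *m W^T).
Proof. by rewrite /ip trmx_mul -mulmxA mxtrace_mulC mulmxA. Qed.

Lemma ip_ge0 p q (A : 'M[R]_(p, q)) : 0 <= ip A A.
Proof. by rewrite ipE; do 2![apply: sumr_ge0 => ? _]; rewrite -expr2 sqr_ge0. Qed.

Lemma ip_eq0 p q (A : 'M[R]_(p, q)) : ip A A = 0 -> A = 0.
Proof.
rewrite ipE => /eqP; rewrite psumr_eq0 => [/allP h|i _]; last first.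
  by apply: sumr_ge0 => j _; rewrite -expr2 sqr_ge0.
apply/matrixP => i j; have /implyP/(_ isT) := h i (mem_index_enum _).
rewrite psumr_eq0 => [/allP/(_ j (mem_index_enum _))/implyP/(_ isT)|? _].
  by rewrite mulf_eq0 orbb mxE => /eqP.
by rewrite -expr2 sqr_ge0.
Qed.

Lemma ip_gt0 p q (A : 'M[R]_(p, q)) : A != 0 -> 0 < ip A A.
Proof.
by move=> A0; rewrite lt_def ip_ge0 andbT; apply: contra_neq A0 => /ip_eq0.
Qed.

Lemma ip_amgm p q (A B : 'M[R]_(p, q)) : 2 * ip A B <= ip A A + ip B B.
Proof.
have := ip_ge0 (A - B); rewrite ipBr !ipBl (ipC B A); lra.
Qed.

Lemma CauchySchwarz_ip p q (A B : 'M[R]_(p, q)) :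
  ip A B <= Num.sqrt (ip A A) * Num.sqrt (ip B B).
Proof.
have [->|A0] := eqVneq A 0; first by rewrite !ip0l sqrtr0 mul0r.
have [->|B0] := eqVneq B 0; first by rewrite !ip0r sqrtr0 mulr0.
have a0 : 0 < Num.sqrt (ip A A) by rewrite sqrtr_gt0 ip_gt0.
have b0 : 0 < Num.sqrt (ip B B) by rewrite sqrtr_gt0 ip_gt0.
have := ip_amgm ((Num.sqrt (ip A A))^-1 *: A) ((Num.sqrt (ip B B))^-1 *: B).
have h (x : R) : 0 < Num.sqrt x -> (Num.sqrt x)^-1 * ((Num.sqrt x)^-1 * x) = 1.
  rewrite sqrtr_gt0 => x0; have := sqr_sqrtr (ltW x0).
  set y := Num.sqrt x => <-; field.
  by rewrite sqrtr_eq0 -ltNge.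
rewrite !(ipZl, ipZr) !h// => h1.
have : (Num.sqrt (ip B B))^-1 * ((Num.sqrt (ip A A))^-1 * ip A B) <= 1.
  by move: h1; rewrite [X in 2 * X]mulrCA; lra.
by rewrite ler_pdivrMl// mulr1 ler_pdivrMl// mulrC.
Qed.

Lemma frobenius_sqr p q (A : 'M[R]_(p, q)) : frobenius A ^+ 2 = ip A A.
Proof.
rewrite ipE /frobenius sqr_sqrtr //.
by do 2![apply: sumr_ge0 => ? _]; rewrite sqr_ge0.
Qed.

Lemma frobeniusE p q (A : 'M[R]_(p, q)) : frobenius A = Num.sqrt (ip A A).
Proof. by rewrite -frobenius_sqr sqrtr_sqr ger0_norm // sqrtr_ge0. Qed.

Lemma l2norm_sqr p (v : 'cV[R]_p) : l2norm v ^+ 2 = ip v v.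
Proof.
rewrite ipE /l2norm sqr_sqrtr; first by apply: eq_bigr => i _; rewrite big_ord1.
by apply: sumr_ge0 => ? _; rewrite sqr_ge0.
Qed.

Lemma l2normE p (v : 'cV[R]_p) : l2norm v = Num.sqrt (ip v v).
Proof. by rewrite -l2norm_sqr sqrtr_sqr ger0_norm // sqrtr_ge0. Qed.

End InnerProduct.

(** * Existence of singular value decompositions *)

Definition unit_orth (R : realType) (n r : nat) (v : nat -> 'rV[R]_n)
    (x : 'rV[R]_n) : Prop :=
  ip x x = 1 /\ forall i, (i < r)%N -> ip (v i) x = 0.

Section SVD.
Import topology normedtype derive.
Import numFieldNormedType.Exports.
Context {R : realType}.

(** The conditions are r linear equations in n > r unknowns. *)
Lemma unit_orth_exists n r (v : nat -> 'rV[R]_n) :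
  (r < n)%N -> exists x, unit_orth r v x.
Proof.
move=> rn; pose M : 'M[R]_(n, r) := \matrix_(i, j) v j 0 i.
have /rowV0Pn[x /sub_kermxP xM x0] : kermx M != 0.
  by rewrite -mxrank_eq0 mxrank_ker subn_eq0 -ltnNge (leq_ltn_trans (rank_leq_col M)).
have h i : (i < r)%N -> ip (v i) x = 0.
  move=> ir; have /matrixP/(_ 0 (Ordinal ir)) := xM.
  rewrite !mxE ipE big_ord1 => h; rewrite -[RHS]h.
  by apply: eq_bigr => j _; rewrite !mxE mulrC.
have x2 := ip_gt0 x0.
exists ((Num.sqrt (ip x x))^-1 *: x); split => [|i ir]; last by rewrite ipZr h// mulr0.
rewrite ipZr ipZl mulrA -expr2 exprVn sqr_sqrtr ?ltW// mulVf//.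
by rewrite gt_eqF.
Qed.

Lemma ip_continuous_r n (v : 'rV[R]_n) : continuous (fun x => ip v x).
Proof.
have -> : (fun x => ip v x) = (fun x => \sum_i v 0 i * x 0 i).
  by apply/funext => x; rewrite ipE big_ord1.
apply: continuous_big => [|i _ x]; first exact: add_continuous.
by apply: continuousM; [exact: cst_continuous|exact: coord_continuous].
Qed.

Lemma ip_continuous_diag n : continuous (fun x : 'rV[R]_n => ip x x).
Proof.
have -> : (fun x : 'rV[R]_n => ip x x) = (fun x => \sum_i x 0 i * x 0 i).
  by apply/funext => x; rewrite ipE big_ord1.
apply: continuous_big => [|i _ x]; first exact: add_continuous.
by apply: continuousM; exact: coord_continuous.
Qed.

Lemma unit_orth_compact n r (v : nat -> 'rV[R]_n) :
  compact [set x | unit_orth r v x]%classic.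
Proof.
apply: (@subclosed_compact _ _
    [set x : 'rV[R]_n | forall i, `[-1, 1]%classic (x ord0 i)]%classic).
- have -> : [set x | unit_orth r v x]%classic =
      ([set x | ip x x = 1] `&`
       \bigcap_(i in [set i | (i < r)%N]) [set x | ip (v i) x = 0])%classic.
    by apply/seteqP; split.
  apply: closedI.
    apply: (@preimage_closed _ _ (fun x : 'rV[R]_n => ip x x) [set x | x = 1]%classic).
      by move=> x _; exact: ip_continuous_diag.
    exact: closed_eq.
  apply: closed_bigI => i _.
  apply: (@preimage_closed _ _ (fun x : 'rV[R]_n => ip (v i) x) [set x | x = 0]%classic).
    by move=> x _; exact: ip_continuous_r.
  exact: closed_eq.
- by apply: (@rV_compact R n (fun=> `[-1, 1]%classic)) => i; exact: segment_compact.
- move=> x [x1 _] i /=; rewrite in_itv /= -ler_norml.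
  rewrite -(@ler_pXn2r _ 2)// ?nnegrE// expr1n real_normK ?num_real// -x1.
  rewrite ipE big_ord1 (bigD1 i)//= expr2 lerDl sumr_ge0// => j _.
  by rewrite -expr2 sqr_ge0.
Qed.

Lemma bilinear_continuous n1 n2 (X : 'M[R]_(n1, n2)) :
  continuous (fun z : 'rV[R]_n1 * 'rV[R]_n2 => ip z.1 (z.2 *m X^T)).
Proof.
have -> : (fun z : 'rV[R]_n1 * 'rV[R]_n2 => ip z.1 (z.2 *m X^T)) =
    (fun z => \sum_i \sum_j z.1 0 i * (z.2 0 j * X i j)).
  apply/funext => z; rewrite ipE big_ord1; apply: eq_bigr => i _.
  by rewrite mxE mulr_sumr; apply: eq_bigr => j _; rewrite mxE.
apply: continuous_big => [|i _]; first exact: add_continuous.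
apply: continuous_big => [|j _ z]; first exact: add_continuous.
have fst_i : {for z, continuous (fun z : 'rV[R]_n1 * 'rV[R]_n2 => z.1 0 i)}.
  apply: (@continuous_comp _ _ _ fst (fun x : 'rV[R]_n1 => x 0 i)).
    exact: cvg_fst.
  exact: coord_continuous.
have snd_j : {for z, continuous (fun z : 'rV[R]_n1 * 'rV[R]_n2 => z.2 0 j)}.
  apply: (@continuous_comp _ _ _ snd (fun x : 'rV[R]_n2 => x 0 j)).
    exact: cvg_snd.
  exact: coord_continuous.
have cX : {for z, continuous (fun=> X i j : R)} by exact: cst_continuous.
exact: (continuousM fst_i (continuousM snd_j cX)).
Qed.

(** A linear form w on the unit sphere of a subspace containing w is maximal
    only in the direction of w: comparing y with w / |w| gives |w| <= <y, w>,
    and then |w - <y, w> y|^2 = |w|^2 - <y, w>^2 <= 0. *)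
Lemma unit_orth_max n r (v : nat -> 'rV[R]_n) (w y : 'rV[R]_n) :
  (forall i, (i < r)%N -> ip (v i) w = 0) -> unit_orth r v y ->
  (forall y', unit_orth r v y' -> ip y' w <= ip y w) -> w = ip y w *: y.
Proof.
move=> vw yu ymax; have [y1 _] := yu.
have [->|w0] := eqVneq w 0; first by rewrite ip0r scale0r.
have w2 := ip_gt0 w0.
have s0 : 0 < Num.sqrt (ip w w) by rewrite sqrtr_gt0.
have sw : ip w w = Num.sqrt (ip w w) ^+ 2 by rewrite sqr_sqrtr// ltW.
move: (Num.sqrt (ip w w)) s0 sw => a a0 sw.
have /ymax : unit_orth r v (a^-1 *: w).
  split => [|i ir]; last by rewrite ipZr vw// mulr0.
  by rewrite ipZr ipZl sw; field; rewrite gt_eqF.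
have -> : ip (a^-1 *: w) w = a by rewrite ipZl sw; field; rewrite gt_eqF.
move=> aw; apply/eqP; rewrite -subr_eq0; apply/eqP/ip_eq0/eqP.
rewrite eq_le ip_ge0 andbT !(ipBl, ipBr, ipZl, ipZr) y1 sw (ipC w y).
by nra.
Qed.

(** Successive maximisers of <y, X x> over unit vectors orthogonal to the
    previous ones are singular vectors: X x is orthogonal to the previous left
    vectors because these satisfy u_i X = s_i v_i, so [unit_orth_max] applies to
    it, and symmetrically to y X.  Recording the maximality of each pair keeps
    the ordering of the singular values available for the end. *)
Lemma partial_svd n1 n2 (X : 'M[R]_(n1, n2)) (r : nat) :
  (r <= n1)%N -> (r <= n2)%N ->
  exists (u : nat -> 'rV[R]_n1) (v : nat -> 'rV[R]_n2) (s : nat -> R),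
  forall i, (i < r)%N ->
  [/\ unit_orth i u (u i), unit_orth i v (v i),
      v i *m X^T = s i *: u i, u i *m X = s i *: v i
    & forall y x, unit_orth i u y -> unit_orth i v x ->
        ip y (x *m X^T) <= s i].
Proof.
elim: r => [|r IH] rn1 rn2; first by exists (fun=> 0), (fun=> 0), (fun=> 0).
have [u [v [s uvs]]] := IH (ltnW rn1) (ltnW rn2).
have [[y0 y0u] [x0 x0v]] := (unit_orth_exists u rn1, unit_orth_exists v rn2).
have [] := @compact_EVT_max _ _ _
    ([set y | unit_orth r u y] `*` [set x | unit_orth r v x])%classic _
    (compact_setX (@unit_orth_compact n1 r u) (@unit_orth_compact n2 r v))
    (continuous_subspaceT (@bilinear_continuous _ _ X)).
  by exists (y0, x0).
move=> [y x]; rewrite in_setE => -[/= yu xv] yxmax0.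
have yxmax y' x' : unit_orth r u y' -> unit_orth r v x' ->
    ip y' (x' *m X^T) <= ip y (x *m X^T).
  by move=> yu' xv'; apply: (yxmax0 (y', x')); rewrite in_setE; split.
have xX : x *m X^T = ip y (x *m X^T) *: y.
  apply: (unit_orth_max _ yu) => [i ir|y' yu']; last exact: yxmax.
  have [_ _ _ uX _] := uvs i ir.
  by rewrite -ip_mulr uX ipZl xv.2// mulr0.
have yX : y *m X = ip y (x *m X^T) *: x.
  have -> : ip y (x *m X^T) = ip x (y *m X) by rewrite -ip_mulr ipC.
  apply: (unit_orth_max _ xv) => [i ir|x' xv'].
    have [_ _ vX _ _] := uvs i ir.
    by rewrite ipC ip_mulr vX ipZr (ipC y) yu.2// mulr0.
  by rewrite !(ipC _ (y *m X)) !ip_mulr; exact: yxmax.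
exists (fun i => if (i < r)%N then u i else y),
  (fun i => if (i < r)%N then v i else x),
  (fun i => if (i < r)%N then s i else ip y (x *m X^T)) => i; rewrite ltnS => ir.
have e n (f : nat -> 'rV[R]_n) z t :
    unit_orth i (fun j => if (j < r)%N then f j else z) t <-> unit_orth i f t.
  by split=> -[t1 tf]; split=> // j ji; have := tf j ji; rewrite (leq_trans ji ir).
have [ltir|leri] := ltnP i r.
  have [a b c d f] := uvs i ltir.
  by split=> //; [exact/e|exact/e|move=> y' x' /e ? /e ?; exact: f].
have {leri} eir : i = r by apply/eqP; rewrite eqn_leq ir.
subst i; split=> //; [exact/e|exact/e|move=> y' x' /e ? /e ?; exact: yxmax].
Qed.

Lemma unit_orth_orthonormal n p (f : nat -> 'rV[R]_n) :
  (forall i, (i < p)%N -> unit_orth i f (f i)) ->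
  let F : 'M[R]_(n, p) := \matrix_(i, j) f j 0 i in F^T *m F = 1%:M.
Proof.
move=> h F; apply/matrixP => i j; rewrite !mxE.
have -> : \sum_k F^T i k * F k j = ip (f i) (f j).
  by rewrite ipE big_ord1; apply: eq_bigr => k _; rewrite !mxE.
have [ij|ij|eij] := ltngtP i j.
- by rewrite (h j _).2// -val_eqE/= (ltn_eqF ij).
- by rewrite ipC (h i _).2// -val_eqE/= (gtn_eqF ij).
- by rewrite (val_inj eij) (h j _).1// eqxx.
Qed.

Lemma svd_truncE n1 n2 k (s : 'rV[R]_n1) (U : 'M[R]_n1) (V : 'M[R]_(n2, n1)) :
  svd_trunc k s U V =
  U *m diag_mx (\row_i (if (i < k)%N then s 0 i else 0)) *m V^T.
Proof.
rewrite /svd_trunc big_mkcond; apply/matrixP => i j; rewrite summxE mxE.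
apply: eq_bigr => l _; rewrite mul_mx_diag [RHS]mulrC !mxE.
case: ifP => _; last by rewrite !mxE mulr0 mulr0.
by rewrite !mxE big_ord1 !mxE; ring.
Qed.

Lemma svd_trunc_all n1 n2 (s : 'rV[R]_n1) (U : 'M[R]_n1) (V : 'M[R]_(n2, n1)) :
  svd_trunc n1 s U V = U *m diag_mx s *m V^T.
Proof.
rewrite svd_truncE; congr (_ *m diag_mx _ *m _).
by apply/rowP => i; rewrite mxE ltn_ord.
Qed.

(** The sign flip y |-> - y turns maximality into nonnegativity, and each pair
    is a competitor in the maximisation that produced the earlier ones, which
    gives the ordering. *)
Theorem svd_exists n1 n2 (X : 'M[R]_(n1, n2)) : (n1 <= n2)%N ->
  exists s U V, is_svd X s U V.
Proof.
move=> n12; have [u [v [s h]]] := partial_svd X (leqnn n1) n12.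
pose U : 'M[R]_n1 := \matrix_(i, j) u j 0 i.
pose V : 'M[R]_(n2, n1) := \matrix_(i, j) v j 0 i.
have UU : U^T *m U = 1%:M by apply: unit_orth_orthonormal => i /h[].
have VV : V^T *m V = 1%:M by apply: unit_orth_orthonormal => i /h[].
have sE i : (i < n1)%N -> s i = ip (u i) (v i *m X^T).
  by move=> ni; have [[u1 _] _ -> _ _] := h i ni; rewrite ipZr u1 mulr1.
exists (\row_i s i), U, V; split=> // [i|i j ij|].
- rewrite mxE; have [uu vv vX _ smax] := h i (ltn_ord i).
  have /smax/(_ vv) : unit_orth i u (- u i).
    by split=> [|j ji]; rewrite ?ipNr ?ipNl ?opprK ?uu.1// uu.2// oppr0.
  by rewrite ipNl -sE//; lra.
- rewrite !mxE; have [_ _ _ _ smax] := h i (ltn_ord i).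
  have [uu vv _ _ _] := h j (ltn_ord j); rewrite (sE j)//.
  apply: smax.
    by split=> [|l li]; [exact: uu.1|exact/uu.2/(leq_trans li)].
  by split=> [|l li]; [exact: vv.1|exact/vv.2/(leq_trans li)].
- rewrite svd_trunc_all; have UtX : U^T *m X = diag_mx (\row_i s i) *m V^T.
    apply/row_matrixP => i; rewrite !row_mul row_diag_mx -scalemxAl -rowE mxE.
    have [_ _ _ uX _] := h i (ltn_ord i).
    have -> : row i U^T = u i by apply/rowP => j; rewrite !mxE.
    by rewrite uX; congr (_ *: _); apply/rowP => j; rewrite !mxE.
  by rewrite -mulmxA -UtX mulmxA (mulmx1C UU) mul1mx.
Qed.

End SVD.

(** * Duality for the nuclear norm *)

Section Duality.
Context {R : realType}.

Lemma ip_col p q r (A : 'M[R]_(p, q)) (B : 'M[R]_(p, r)) i j :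
  ip (col i A) (col j B) = (A^T *m B) i j.
Proof. by rewrite ipE mxE; apply: eq_bigr => l _; rewrite big_ord1 !mxE. Qed.

Lemma ip_diag p q r (W : 'M[R]_(p, q)) (c : 'rV[R]_r) (U : 'M[R]_(p, r))
    (V : 'M[R]_(q, r)) :
  ip W (U *m diag_mx c *m V^T) = \sum_i c 0 i * (U^T *m W *m V) i i.
Proof.
rewrite ipC ip_mulr ip_mull trmxK mulmxA ipE; apply: eq_bigr => i _.
rewrite (bigD1 i)//= big1 => [|j ji]; first by rewrite !mxE eqxx mulr1n addr0.
by rewrite mxE eq_sym (negbTE ji) mulr0n mul0r.
Qed.

Lemma isometry_entry p q (F G : 'M[R]_(p, q)) i :
  F^T *m F = 1%:M -> G^T *m G = 1%:M -> `|(F^T *m G) i i| <= 1.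
Proof.
move=> FF GG; have := ip_amgm (col i F) (col i G).
have := ip_amgm (- col i F) (col i G).
rewrite !(ipNl, ipNr) !ip_col FF GG !mxE eqxx /= => h1 h2.
by rewrite ler_norml; apply/andP; split; lra.
Qed.

Lemma coisometry_entry p q r (W : 'M[R]_(p, q)) (U : 'M[R]_(p, r))
    (V : 'M[R]_(q, r)) i :
  W *m W^T = 1%:M -> U^T *m U = 1%:M -> V^T *m V = 1%:M ->
  `|(U^T *m W *m V) i i| <= 1.
Proof.
move=> WW UU VV; have -> : U^T *m W = (W^T *m U)^T by rewrite trmx_mul trmxK.
apply: isometry_entry => //.
by rewrite trmx_mul trmxK mulmxA -(mulmxA U^T) WW mulmx1.
Qed.

(** The easy half of the duality between the nuclear and the operator norm. *)
Lemma ip_coisometry_le p q r (W : 'M[R]_(p, q)) (c : 'rV[R]_r) (U : 'M[R]_(p, r))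
    (V : 'M[R]_(q, r)) :
  W *m W^T = 1%:M -> U^T *m U = 1%:M -> V^T *m V = 1%:M ->
  (forall i, 0 <= c 0 i) -> ip W (U *m diag_mx c *m V^T) <= \sum_i c 0 i.
Proof.
move=> WW UU VV c0; rewrite ip_diag; apply: ler_sum => i _.
have := coisometry_entry i WW UU VV; rewrite ler_norml => /andP[_ h].
by rewrite -[leRHS]mulr1 ler_wpM2l.
Qed.

Section SingularSystem.
Variables (n1 n2 : nat) (U : 'M[R]_n1) (V : 'M[R]_(n2, n1)).
Hypotheses (UU : U^T *m U = 1%:M) (VV : V^T *m V = 1%:M).

Lemma polar_coisometry : (U *m V^T) *m (U *m V^T)^T = 1%:M.
Proof. by rewrite trmx_mul trmxK mulmxA -(mulmxA U) VV mulmx1 (mulmx1C UU). Qed.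

Lemma polar_mull : U^T *m (U *m V^T) = V^T.
Proof. by rewrite mulmxA UU mul1mx. Qed.

Lemma ip_polar (c : 'rV[R]_n1) :
  ip (U *m V^T) (U *m diag_mx c *m V^T) = \sum_i c 0 i.
Proof.
rewrite ip_diag; apply: eq_bigr => i _.
by rewrite polar_mull VV mxE eqxx mulr1.
Qed.

End SingularSystem.

Lemma is_svdE n1 n2 (X : 'M[R]_(n1, n2)) s U V :
  is_svd X s U V -> X = U *m diag_mx s *m V^T.
Proof. by move=> [_ _ _ _ ->]; rewrite svd_trunc_all. Qed.

(** U V^T attains in X the value sum s, while no coisometry exceeds sum s' there.
    By symmetry the sum of the singular values does not depend on the
    decomposition. *)
Lemma svd_sum_le n1 n2 (X : 'M[R]_(n1, n2)) s U V s' U' V' :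
  is_svd X s U V -> is_svd X s' U' V' -> \sum_i s 0 i <= \sum_i s' 0 i.
Proof.
move=> h h'; have [UU VV _ _ _] := h; have [UU' VV' s'0 _ _] := h'.
rewrite -(ip_polar UU VV) -(is_svdE h) (is_svdE h').
exact: ip_coisometry_le (polar_coisometry UU VV) _ _ _.
Qed.

Lemma nuclear_svd n1 n2 (X : 'M[R]_(n1, n2)) s U V :
  is_svd X s U V -> nuclear X = \sum_i s 0 i.
Proof.
move=> h; rewrite /nuclear /singular_values.
have [U' [V' h']] := @xgetPex _ 0 [set s | exists U V, is_svd X s U V]%classic
  (ex_intro _ s (ex_intro _ U (ex_intro _ V h))).
by apply/le_anti/andP; split; [exact: svd_sum_le h' h|exact: svd_sum_le h h'].
Qed.

Lemma nuclear_ge n1 n2 (W X : 'M[R]_(n1, n2)) :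
  (n1 <= n2)%N -> W *m W^T = 1%:M -> ip W X <= nuclear X.
Proof.
move=> n12 WW; have [s [U [V h]]] := svd_exists X n12.
rewrite (nuclear_svd h) (is_svdE h); have [UU VV s0 _ _] := h.
exact: ip_coisometry_le.
Qed.

End Duality.

(** * Orthogonal matrices moving few vectors *)

Section Householder.
Context {R : realType}.

Lemma mul_colT n (x y : 'cV[R]_n) : x^T *m y = (ip x y)%:M.
Proof.
by apply/matrixP => i j; rewrite !ord1 [RHS]mxE eqxx mulr1n /ip /mxtrace big_ord1.
Qed.

(** The projection onto the range of P and r: the rank-one term along the
    component e of r orthogonal to that range is added to P.  When e = 0 the
    inverse of <e, e> is 0 as well, so the same formula returns P. *)
Lemma extend_projection n (P : 'M[R]_n) (r : 'cV[R]_n) :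
  P^T = P -> P *m P = P ->
  exists P', [/\ P'^T = P', P' *m P' = P', P *m P' = P, r^T *m P' = r^T
               & \tr P' <= \tr P + 1].
Proof.
move=> Ps Pi; have [e eE] : exists e, e = r - P *m r by exists (r - P *m r).
pose d := (ip e e)^-1.
have Pe : P *m e = 0 by rewrite eE mulmxBr mulmxA Pi subrr.
have eP : e^T *m P = 0 by rewrite -[P]Ps -trmx_mul Pe trmx0.
have er : ip r e = ip e e.
  by rewrite {2}eE ipBl ip_mull Ps Pe ip0r subr0.
have de : d *: (ip e e *: e^T) = e^T.
  have [->|e0] := eqVneq e 0; first by rewrite trmx0 !scaler0.
  by rewrite scalerA mulVf ?scale1r// gt_eqF// ip_gt0.
exists (P + d *: (e *m e^T)); split.
- by rewrite linearD linearZ /= Ps trmx_mul trmxK.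
- have PE : P *m (e *m e^T) = 0 by rewrite mulmxA Pe mul0mx.
  have EP : (e *m e^T) *m P = 0 by rewrite -mulmxA eP mulmx0.
  have EE : d *: ((e *m e^T) *m (e *m e^T)) = e *m e^T.
    rewrite -mulmxA (mulmxA e^T) mul_colT mul_scalar_mx.
    by rewrite scalemxAr de.
  rewrite mulmxDr !mulmxDl Pi -!scalemxAl -!scalemxAr PE EP EE.
  by rewrite !scaler0 addr0 add0r.
- by rewrite mulmxDr Pi -scalemxAr mulmxA Pe mul0mx scaler0 addr0.
- rewrite mulmxDr -scalemxAr mulmxA mul_colT er mul_scalar_mx de.
  by rewrite eE linearB /= trmx_mul Ps addrC subrK.
- rewrite linearD linearZ /= lerD2l mxtrace_mulC mul_colT mxtrace_scalar mulr1n.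
  have [->|e0] := eqVneq e 0; first by rewrite ip0l mulr0.
  by rewrite mulVf// gt_eqF// ip_gt0.
Qed.

(** One reflection per vector: once Q sends the first k columns of F to those of
    G, the reflection exchanging Q f and g, for the next columns f and g, fixes
    the columns of G already reached, since these are orthogonal to Q f and g.
    The projection P onto the span of the reflection vectors records that Q is
    the identity on a subspace of codimension at most k. *)
Lemma orth_extension n p k (F G : 'M[R]_(n, p)) :
  (k <= p)%N -> F^T *m F = 1%:M -> G^T *m G = 1%:M ->
  exists Q P : 'M[R]_n,
    [/\ Q^T *m Q = 1%:M, P^T = P /\ P *m P = P, (1%:M - Q) *m P = 1%:M - Q,
        \tr P <= k%:R
      & forall i : 'I_p, (i < k)%N -> Q *m col i F = col i G].
Proof.
move=> kp FF GG; elim: k kp => [|k IH] kp.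
  exists 1%:M, 0; rewrite trmx1 mulmx1 trmx0 mulmx0 subrr mulmx0 mxtrace0.
  by split.
have [Q [P [QQ [Ps Pi] QP trP QF]]] := IH (ltnW kp).
have trP' : \tr P <= k.+1%:R by rewrite (le_trans trP)// ler_nat.
pose j := Ordinal kp; pose f := Q *m col j F; pose g := col j G.
have [fg|fg] := eqVneq f g.
  exists Q, P; split=> // i; rewrite ltnS leq_eqVlt => /orP[/eqP ij|/QF//].
  by have -> : i = j by exact: val_inj.
pose r := f - g; pose c := 2 / ip r r.
have rr : 0 < ip r r by rewrite ip_gt0// subr_eq0.
have cr : c * ip r r = 2 by rewrite mulrAC -mulrA divff ?mulr1// gt_eqF.
have ff : ip f f = 1 by rewrite /f ip_mull mulmxA QQ mul1mx ip_col FF mxE eqxx.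
have gg : ip g g = 1 by rewrite ip_col GG mxE eqxx.
pose T := 1%:M - c *: (r *m r^T).
have Ts : T^T = T by rewrite linearB linearZ /= trmx1 trmx_mul trmxK.
have TE (q : nat) (A : 'M[R]_(n, q)) : T *m A = A - c *: (r *m (r^T *m A)).
  by rewrite mulmxBl mul1mx -scalemxAl mulmxA.
have TT : T *m T = 1%:M.
  rewrite TE {2}/T mulmxBr mulmx1 -scalemxAr mulmxA mul_colT mul_scalar_mx.
  rewrite scalerA cr scaler_nat mulr2n opprD addrA subrr sub0r mulmxN scalerN opprK.
  by rewrite subrK.
have Tf : T *m f = g.
  rewrite TE mul_colT mul_mx_scalar scalerA.
  have -> : c * ip r f = 1.
    have : 2 * ip r f = ip r r by rewrite /r !(ipBl, ipBr) ff gg (ipC g f); ring.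
    by move: cr => /[swap] <-; rewrite mulrCA => h; lra.
  by rewrite scale1r /r opprB addrC subrK.
have [P' [P's P'i PP' rP' trP'']] := extend_projection r Ps Pi.
have QP' : (1%:M - Q) *m P' = 1%:M - Q by rewrite -QP -mulmxA PP'.
exists (T *m Q), P'; split=> //.
- by rewrite trmx_mul Ts mulmxA -(mulmxA Q^T) TT mulmx1.
- have rQ : r^T *m Q *m P' = r^T *m Q.
    have -> : Q = 1%:M - (1%:M - Q) by rewrite subKr.
    by rewrite mulmxBr mulmx1 mulmxBl rP' -mulmxA QP'.
  rewrite TE opprB addrCA addrC mulmxDl QP' -scalemxAl -!mulmxA; congr (_ + _ *: (_ *m _)).
  by rewrite mulmxA.
- by rewrite (le_trans trP'')// -addn1 natrD lerD2r.
move=> i; rewrite ltnS leq_eqVlt => /orP[/eqP ij|ik].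
  by have -> : i = j by [exact: val_inj]; rewrite -mulmxA.
rewrite -mulmxA QF// TE mul_colT.
have -> : ip r (col i G) = 0.
  have ji : (j == i) = false by rewrite -val_eqE /= gtn_eqF.
  rewrite ipBl -{1}(QF _ ik) ip_mull mulmxA QQ mul1mx !ip_col FF GG !mxE ji.
  by rewrite subrr.
by rewrite mul_mx_scalar scale0r scaler0 subr0.
Qed.

(** tr (Q P) = <P, Q P>, where both P and Q P have squared norm tr P. *)
Lemma trace_orth_projection n (Q P : 'M[R]_n) :
  Q^T *m Q = 1%:M -> P^T = P -> P *m P = P -> `|\tr (Q *m P)| <= \tr P.
Proof.
move=> QQ Ps Pi.
have PP : ip P P = \tr P by rewrite /ip Ps Pi.
have QPP : ip (Q *m P) (Q *m P) = \tr P by rewrite ip_mull mulmxA QQ mul1mx.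
have E : ip P (Q *m P) = \tr (Q *m P).
  by rewrite /ip Ps mxtrace_mulC -mulmxA Pi.
have := ip_amgm P (Q *m P); have := ip_amgm (- P) (Q *m P).
rewrite !(ipNl, ipNr) PP QPP E => h1 h2.
by rewrite ler_norml; apply/andP; split; lra.
Qed.

(** With N = 1 - V V^T, the trace of the compression is
    tr (1 - Q) - tr ((1 - Q) N).  The second trace is nonnegative, and the first
    equals tr P - tr (Q P), which is at most 2 tr P. *)
Lemma compression_trace_le n p (V : 'M[R]_(n, p)) (Q P : 'M[R]_n) k :
  V^T *m V = 1%:M -> Q^T *m Q = 1%:M -> P^T = P -> P *m P = P ->
  (1%:M - Q) *m P = 1%:M - Q -> \tr P <= k%:R ->
  \sum_i (1 - (V^T *m Q *m V) i i) <= 2 * k%:R.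
Proof.
move=> VV QQ Ps Pi QP trP.
have trB (A B : 'M[R]_n) : \tr (A - B) = \tr A - \tr B by rewrite linearB.
pose N := 1%:M - V *m V^T.
have VN : V^T *m N = 0 by rewrite mulmxBr mulmx1 mulmxA VV mul1mx subrr.
have Ns : N^T = N by rewrite linearB /= trmx1 trmx_mul trmxK.
have Ni : N *m N = N by rewrite {1}/N mulmxBl mul1mx -mulmxA VN mulmx0 subr0.
have := trace_orth_projection QQ Ns Ni; rewrite ler_norml => /andP[_ hN].
have := trace_orth_projection QQ Ps Pi; rewrite ler_norml => /andP[hP _].
have -> : \sum_i (1 - (V^T *m Q *m V) i i) = \tr (1%:M - Q) - (\tr N - \tr (Q *m N)).
  transitivity (\tr (V^T *m (1%:M - Q) *m V)).
    rewrite mulmxBr mulmx1 mulmxBl VV; apply: eq_bigr => i _.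
    by rewrite [in RHS]mxE [in X in _ = X + _]mxE eqxx [in RHS]mxE.
  have -> : \tr N - \tr (Q *m N) = \tr ((1%:M - Q) *m N).
    by rewrite [in RHS]mulmxBl mul1mx [RHS]trB.
  have -> : (1%:M - Q) *m N = (1%:M - Q) - (1%:M - Q) *m V *m V^T.
    by rewrite /N [LHS]mulmxBr mulmx1 -mulmxA.
  rewrite (trB _ (_ *m _)) subKr -mulmxA.
  by rewrite mxtrace_mulC -mulmxA.
have : \tr (1%:M - Q) = \tr P - \tr (Q *m P).
  by rewrite -trB -[X in X - Q *m P]mul1mx -mulmxBl QP.
lra.
Qed.

(** The largest value is obtained by giving weight 2 to the k largest terms:
    h_i (d_i - 2 [i < k]) does not decrease when h_i is replaced by
    h_k. *)
Lemma weighted_sum_le n k (h : 'I_n -> R) (d : 'I_n -> R) :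
  (k < n)%N -> (forall i j : 'I_n, (i <= j)%N -> h j <= h i) ->
  (forall i, 0 <= h i) -> (forall i, 0 <= d i <= 2) -> \sum_i d i <= 2 * k%:R ->
  \sum_i h i * d i <= 2 * \sum_(i < n | (i < k)%N) h i.
Proof.
move=> kn hdec h0 d02 dk; pose a := h (Ordinal kn).
have step : \sum_i h i * d i - 2 * \sum_(i < n | (i < k)%N) h i <=
    a * (\sum_i d i - 2 * k%:R).
  have -> : 2 * k%:R = \sum_(i < n | (i < k)%N) 2 :> R.
    by rewrite -(big_ord_widen _ (fun=> 2 : R) (ltnW kn)) sumr_const card_ord mulr_natr.
  rewrite mulr_sumr !(big_mkcond (fun i : 'I_n => (i < k)%N)) /= -!sumrB mulr_sumr.
  apply: ler_sum => i _; have /andP[d0 d2] := d02 i.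
  case: ifPn => [ik|]; first have : a <= h i by apply: hdec; exact: ltnW.
    by move=> ?; nra.
  by rewrite -leqNgt => ki; rewrite !subr0; apply: ler_wpM2r => //; exact: hdec.
have a0 : 0 <= a by exact: h0.
nra.
Qed.

End Householder.

(** * Perturbation of the nuclear norm *)

Section Perturbation.
Context {R : realType}.

(** Mirsky's inequality sum_i |s_i - h_i| <= nuclear (X + H), with the absolute
    values bounded below by s_i - h_i for i < k and by h_i - s_i for the other
    i.  The certificate is W0 Q with W0 = UH VH^T, where Q sends the first k
    columns of V to those of W0^T U. *)
Theorem nuclear_add_ge n1 n2 k (X H : 'M[R]_(n1, n2)) s U V h UH VH :
  (n1 <= n2)%N -> (k < n1)%N -> is_svd X s U V -> is_svd H h UH VH ->
  \sum_(i < n1 | (i < k)%N) s 0 i - \sum_(i < n1 | ~~ (i < k)%N) s 0 i +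
  (\sum_(i < n1 | ~~ (i < k)%N) h 0 i - \sum_(i < n1 | (i < k)%N) h 0 i)
  <= nuclear (X + H).
Proof.
move=> n12 kn sX sH; have [UU VV s0 _ _] := sX; have [UUH VVH h0 hdec _] := sH.
pose W0 := UH *m VH^T; have WW0 : W0 *m W0^T = 1%:M by exact: polar_coisometry.
pose G := W0^T *m U.
have GG : G^T *m G = 1%:M.
  by rewrite trmx_mul trmxK mulmxA -(mulmxA U^T) WW0 mulmx1.
have [Q [P [QQ [Ps Pi] QP trP QV]]] := orth_extension (ltnW kn) VV GG.
pose W := W0 *m Q.
have WW : W *m W^T = 1%:M.
  by rewrite trmx_mul mulmxA -(mulmxA W0) (mulmx1C QQ) mulmx1.
apply: (le_trans _ (nuclear_ge (X + H) n12 WW)); rewrite ipDr; apply: lerD.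
- rewrite (is_svdE sX) ip_diag [leRHS](bigID (fun i : 'I_n1 => (i < k)%N)) /=.
  apply: lerD; last first.
    rewrite -sumrN; apply: ler_sum => i _.
    have := coisometry_entry i WW UU VV; rewrite ler_norml => /andP[l _].
    by rewrite -mulrN1 ler_wpM2l.
  apply: ler_sum => i ik.
  have -> : U^T *m W *m V = G^T *m (Q *m V) by rewrite trmx_mul trmxK !mulmxA.
  by rewrite -ip_col [col i (Q *m V)]colE -mulmxA -colE QV// ip_col GG mxE eqxx mulr1.
- have WE : UH^T *m W = VH^T *m Q by rewrite mulmxA polar_mull.
  rewrite (is_svdE sH) ip_diag WE.
  have d02 (i : 'I_n1) : 0 <= 1 - (VH^T *m Q *m VH) i i <= 2.
    have := coisometry_entry i (mulmx1C QQ) VVH VVH.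
    by rewrite ler_norml => /andP[? ?]; apply/andP; split; lra.
  have := weighted_sum_le kn hdec h0 d02 (compression_trace_le VVH QQ Ps Pi QP trP).
  have -> : \sum_i h 0 i * (1 - (VH^T *m Q *m VH) i i) =
      \sum_i h 0 i - \sum_i h 0 i * (VH^T *m Q *m VH) i i.
    by rewrite -sumrB; apply: eq_bigr => i _; rewrite mulrBr mulr1.
  rewrite (bigID (fun i : 'I_n1 => (i < k)%N) _ (fun i => h 0 i)) /=; lra.
Qed.

End Perturbation.

(** * Linear forms on a box-constrained simplex *)

(** A linear form on the polytope 0 <= w <= a, sum w <= L a, supported in S, is
    maximal at a times the indicator of at most L indices.  For a best such set
    J, the number th below is the largest value of g off J, or 0: it separates
    the values of g in J from those off J, and vanishes when J has room left. *)
Lemma sparse_dominates (R : realType) n (S : {set 'I_n}) (L : nat) (a : R)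
    (g w : 'I_n -> R) :
  0 <= a -> (forall i, 0 <= w i <= a) -> (forall i, i \notin S -> w i = 0) ->
  \sum_i w i <= L%:R * a ->
  exists J : {set 'I_n}, [/\ J \subset S, (#|J| <= L)%N
    & \sum_i w i * g i <= a * \sum_(i in J) g i].
Proof.
move=> a0 wa wS wL.
pose adm := [pred J : {set 'I_n} | (J \subset S) && (#|J| <= L)%N].
have adm0 : adm set0 by rewrite /= sub0set cards0.
have [J /andP[JS JL] Jmax] :=
  @arg_maxP _ R _ set0 adm (fun J : {set 'I_n} => \sum_(i in J) g i) adm0.
have gJ i : i \in J -> 0 <= g i.
  move=> iJ; have /Jmax : adm (J :\ i).
    rewrite /= (fintype.subset_trans (subsetDl _ _) JS) (leq_trans _ JL)//.
    by rewrite subset_leq_card// subsetDl.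
  by rewrite /= [leRHS](big_setD1 i)//= lerDr.
have gswap i j : i \in J -> j \in S -> j \notin J -> g j <= g i.
  move=> iJ jS jJ; have jJi : j \notin J :\ i by rewrite !inE negb_and jJ orbT.
  have /Jmax : adm (j |: (J :\ i)).
    rewrite /= subUset sub1set jS (fintype.subset_trans (subsetDl _ _) JS) /=.
    by rewrite cardsU1 jJi (cardsD1 i J) iJ in JL *.
  by rewrite /= big_setU1//= [leRHS](big_setD1 i)//= lerD2r.
have gout j : (#|J| < L)%N -> j \in S -> j \notin J -> g j <= 0.
  move=> ltJL jS jJ; have /Jmax : adm (j |: J).
    by rewrite /= subUset sub1set jS JS /= cardsU1 jJ.
  by rewrite /= big_setU1//= gerDr.
pose th := \big[Num.max/0]_(j in S :\: J) g j.
have th0 : 0 <= th by apply: bigmax_ge_id.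
have thout j : j \in S -> j \notin J -> g j <= th.
  by move=> jS jJ; apply: (bigmax_sup j) => //; rewrite inE jJ.
have thin i : i \in J -> th <= g i.
  move=> iJ; apply: bigmax_le; first exact: gJ.
  by move=> j; rewrite inE => /andP[jJ jS]; exact: gswap.
have thL : th * (L%:R - #|J|%:R) = 0.
  move: JL; rewrite leq_eqVlt => /orP[/eqP->|JL]; first by rewrite subrr mulr0.
  suff -> : th = 0 by rewrite mul0r.
  apply/le_anti; rewrite th0 andbT; apply: bigmax_le => // j.
  by rewrite inE => /andP[jJ jS]; exact: gout.
exists J; split=> //.
have step : \sum_i w i * (g i - th) <= \sum_(i in J) a * (g i - th).
  rewrite [leRHS]big_mkcond /=; apply: ler_sum => i _.
  have /andP[w0 w1] := wa i; case: ifPn => iJ.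
    by apply: ler_wpM2r => //; rewrite subr_ge0 thin.
  have [iS|iS] := boolP (i \in S); last by rewrite wS// mul0r.
  by rewrite mulr_ge0_le0// subr_le0 thout.
have e1 : \sum_i w i * (g i - th) = \sum_i w i * g i - th * \sum_i w i.
  by rewrite mulr_sumr -sumrB; apply: eq_bigr => i _; ring.
have e2 : \sum_(i in J) a * (g i - th) = a * \sum_(i in J) g i - a * (th * #|J|%:R).
  by rewrite -mulr_sumr sumrB sumr_const mulrBr mulr_natr.
rewrite e1 e2 in step.
have : th * \sum_i w i <= th * (L%:R * a) by exact: ler_wpM2l.
have : th * (L%:R * a) = a * (th * #|J|%:R).
  by move/eqP: thL; rewrite mulrBr subr_eq0 => /eqP e; rewrite mulrA e mulrC.
lra.
Qed.

(** * The robust null space property *)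

Section NullSpace.
Context {R : realType} {n1 n2 m : nat}.
Variable A : 'I_m -> 'M[R]_(n1, n2).

Lemma measure_mapE X i : measure_map A X i 0 = ip X (A i).
Proof. by rewrite mxE. Qed.

Lemma measure_mapD X Y : measure_map A (X + Y) = measure_map A X + measure_map A Y.
Proof. by apply/colP => i; rewrite measure_mapE [RHS]mxE !measure_mapE ipDl. Qed.

Lemma measure_mapZ a X : measure_map A (a *: X) = a *: measure_map A X.
Proof. by apply/colP => i; rewrite measure_mapE [RHS]mxE !measure_mapE ipZl. Qed.

Lemma measure_mapB X Y : measure_map A (X - Y) = measure_map A X - measure_map A Y.
Proof. by rewrite -scaleN1r measure_mapD measure_mapZ scaleN1r. Qed.

Lemma measure_map_adjoint (y : 'cV[R]_m) X :
  ip y (measure_map A X) = ip (\sum_i y i 0 *: A i) X.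
Proof.
rewrite ipE ipC ip_sumr; apply: eq_bigr => i _.
by rewrite big_ord1 measure_mapE ipZr.
Qed.

Variables (U : 'M[R]_n1) (V : 'M[R]_(n2, n1)).
Hypotheses (UU : U^T *m U = 1%:M) (VV : V^T *m V = 1%:M).

(** The isometry property is used only on matrices that share the singular
    vectors of H, where the Frobenius norm is the l2 norm of the coefficients
    and the rank is at most the number of nonzero ones. *)
Let spec (c : 'rV[R]_n1) := U *m diag_mx c *m V^T.

Lemma specD c d : spec (c + d) = spec c + spec d.
Proof. by rewrite /spec linearD /= mulmxDr mulmxDl. Qed.

Lemma specZ a c : spec (a *: c) = a *: spec c.
Proof. by rewrite /spec linearZ /= -scalemxAr -scalemxAl. Qed.

Lemma ip_spec c d : ip (spec c) (spec d) = \sum_i c 0 i * d 0 i.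
Proof.
rewrite ip_diag; apply: eq_bigr => i _; rewrite mulrC; congr (_ * _).
by rewrite !mulmxA UU mul1mx -mulmxA VV mulmx1 mxE eqxx.
Qed.

Lemma rank_spec c : (\rank (spec c) <= #|[set i | (c 0 i != 0)%R]|)%N.
Proof.
apply: (leq_trans (mxrankM_maxl _ _)); apply: (leq_trans (mxrankM_maxr _ _)).
rewrite diag_mx_sum_delta (bigID (fun i => c 0 i != 0)) /= [X in _ + X]big1 => [|i].
  rewrite addr0 -sum1_card.
  rewrite [leqRHS](eq_bigl (fun i => c 0 i != 0)) => [|i]; last by rewrite inE.
  apply: (big_ind2 (fun (M : 'M[R]_n1) d => \rank M <= d)%N).
  - by rewrite mxrank0.
  - by move=> M d M' d' h h'; apply: (leq_trans (mxrank_add _ _)); exact: leq_add.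
  - by move=> i _; apply: (leq_trans (mxrank_scale _ _)); rewrite mxrank_delta.
by rewrite negbK => /eqP->; rewrite scale0r.
Qed.

Variables (N : nat) (delta : R).
Hypothesis rip : rip_bounds A N delta.
Hypothesis delta01 : 0 < delta < 1.

Lemma rip_spec (c : 'rV[R]_n1) (S : {set 'I_n1}) :
  (forall i, i \notin S -> c 0 i = 0) -> (#|S| <= N)%N ->
  (1 - delta) * \sum_i c 0 i ^+ 2 <= ip (measure_map A (spec c)) (measure_map A (spec c)) /\
  ip (measure_map A (spec c)) (measure_map A (spec c)) <= (1 + delta) * \sum_i c 0 i ^+ 2.
Proof.
move=> cS SN; rewrite -l2norm_sqr.
have -> : \sum_i c 0 i ^+ 2 = frobenius (spec c) ^+ 2.
  by rewrite frobenius_sqr ip_spec; apply: eq_bigr => i _; rewrite expr2.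
apply: rip; apply: (leq_trans (rank_spec c)); apply: (leq_trans _ SN).
by apply/subset_leq_card/fintype.subsetP => i; rewrite inE; apply: contraR => /cS ->.
Qed.

(** Apply the upper isometry bound to (1 - delta) c + b d and the lower one to
    (1 + delta) c - b d.  In the difference |A d|^2 cancels, leaving
    4 b <A c, A d> - 4 delta |A c|^2 on one side; the choice of b makes the
    other side nonpositive.  Using this one pair instead of the polarisation of
    c and d gives the factor delta / sqrt (1 - delta^2) of [beta2], where
    polarisation alone would give delta / (1 - delta). *)
Lemma rip_cross (c d : 'rV[R]_n1) (S : {set 'I_n1}) b Y :
  (forall i, i \notin S -> c 0 i = 0 /\ d 0 i = 0) -> (#|S| <= N)%N ->
  (forall i, c 0 i * d 0 i = 0) -> \sum_i d 0 i ^+ 2 <= Y ->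
  b ^+ 2 * Y = (1 - delta ^+ 2) * \sum_i c 0 i ^+ 2 ->
  b * ip (measure_map A (spec c)) (measure_map A (spec d)) <=
  delta * ip (measure_map A (spec c)) (measure_map A (spec c)).
Proof.
move=> cdS SN cd0 dY bY; have /andP[d0 d1] := delta01.
have comb a b' : \sum_i (a *: c + b' *: d) 0 i ^+ 2 =
    a ^+ 2 * (\sum_i c 0 i ^+ 2) + b' ^+ 2 * \sum_i d 0 i ^+ 2.
  rewrite !mulr_sumr -big_split /=; apply: eq_bigr => i _; rewrite !mxE.
  have := cd0 i; move: (c 0 i) (d 0 i) => x y xy.
  by transitivity (a ^+ 2 * x ^+ 2 + b' ^+ 2 * y ^+ 2 + 2 * a * b' * (x * y));
    [ring|rewrite xy mulr0 addr0].
have supp a b' i : i \notin S -> (a *: c + b' *: d) 0 i = 0.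
  by move=> /cdS[ci di]; rewrite !mxE ci di !mulr0 addr0.
have := (rip_spec (supp (1 - delta) b) SN).2.
have := (rip_spec (supp (1 + delta) (- b)) SN).1.
rewrite !comb !specD !specZ !measure_mapD !measure_mapZ !(ipDl, ipDr, ipZl, ipZr).
rewrite (ipC (measure_map A (spec d)) (measure_map A (spec c))).
move: bY dY.
set X := \sum_i c 0 i ^+ 2; set D := \sum_i d 0 i ^+ 2.
set p := ip (measure_map A (spec c)) _; set e := ip (measure_map A (spec c)) _.
set r := ip (measure_map A (spec d)) _ => bY DY low up.
have bD : b ^+ 2 * D <= (1 - delta ^+ 2) * X by rewrite -bY ler_wpM2l// sqr_ge0.
have : delta * (b ^+ 2 * D) <= delta * ((1 - delta ^+ 2) * X) by rewrite ler_pM2l.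
by move: low up; clear; lra.
Qed.

Variables (k : nat) (h : 'rV[R]_n1).
Hypotheses (kN : (k < N)%N) (h0 : forall i, 0 <= h 0 i).

Let q := (N - k)%N.
Let T := \sum_(i < n1 | ~~ (i < k)%N) h 0 i.

(** Here w collects the k leading coefficients and those of B, which exceed the
    average a = T / q, and v the others.  As the entries of B sum to at least
    #|B| a, there are at most q of them and v has total at most (q - #|B|) a,
    which is what [sparse_dominates] needs to replace v by a set J of
    q - #|B| indices. *)
Lemma robust_nsp :
  Num.sqrt (1 - delta) * (Num.sqrt (\sum_(i < n1 | (i < k)%N) h 0 i ^+ 2) -
    delta / Num.sqrt (1 - delta ^+ 2) * (T / Num.sqrt q%:R)) <=
  l2norm (measure_map A (spec h)).
Proof.
have /andP[d0 d1] := delta01.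
have q0 : 0 < q%:R :> R by rewrite ltr0n subn_gt0.
have T0 : 0 <= T by apply: sumr_ge0.
pose a := T / q%:R.
have a0 : 0 <= a by rewrite divr_ge0// ltW.
have Ta : T = q%:R * a by rewrite /a mulrC divfK// gt_eqF.
pose B := [set i : 'I_n1 | ~~ (i < k)%N && (a < h 0 i)].
pose S1 := [set i : 'I_n1 | (i < k)%N] :|: B.
pose w := \row_i (if i \in S1 then h 0 i else 0).
pose v i := if i \in S1 then 0 else h 0 i.
(* k may exceed n1 here, hence an inequality. *)
have topk : (#|[set i : 'I_n1 | (i < k)%N]| <= k)%N.
  have [nk|kn] := leqP n1 k; first by rewrite (leq_trans (max_card _))// card_ord.
  by rewrite -sum1dep_card -(big_ord_widen _ (fun=> 1%N) (ltnW kn)) sum1_card card_ord.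
have BE : \sum_(i in B) h 0 i + \sum_i v i = T.
  rewrite /T [RHS](bigID (mem B)) /=; congr (_ + _).
    by apply: eq_bigl => i; rewrite !inE andbA andbb.
  rewrite [RHS]big_mkcond /=; apply: eq_bigr => i _; rewrite /v !inE negb_and negbK.
  by case: (i < k)%N => //=; case: (a < h 0 i).
have Ba : #|B|%:R * a <= \sum_(i in B) h 0 i.
  rewrite mulr_natl -sumr_const; apply: ler_sum => i.
  by rewrite inE => /andP[_ /ltW].
have v0 i : 0 <= v i by rewrite /v; case: ifP.
have vsum0 : 0 <= \sum_i v i by exact: sumr_ge0.
have Bq : (#|B| <= q)%N.
  have [az|an] := eqVneq a 0.
    have -> : B = set0.
      apply/setP => i; rewrite !inE az; apply/negbTE; rewrite negb_and negbK orbC.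
      have [ik|ik] := boolP (i < k)%N; first by rewrite orbT.
      rewrite orbF -leNgt; have : T = 0 by rewrite Ta az mulr0.
      rewrite /T (bigD1 i)//= => e.
      have : 0 <= \sum_(j < n1 | ~~ (j < k)%N && (j != i)) h 0 j by exact: sumr_ge0.
      lra.
    by rewrite cards0.
  have apos : 0 < a by rewrite lt_def an.
  by rewrite -(ler_nat R) -(ler_pM2r apos); lra.
pose L := (q - #|B|)%N.
have vL : \sum_i v i <= L%:R * a by rewrite natrB// mulrBl; lra.
have va i : 0 <= v i <= a.
  rewrite v0 /v; case: ifPn => // iS.
  move: iS; rewrite !inE negb_or negb_and negbK => /andP[ik].
  by rewrite (negbTE ik) /= -leNgt.
have vS i : i \notin ~: S1 -> v i = 0 by rewrite inE negbK /v => ->.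
pose M := \sum_i measure_map A (spec w) i 0 *: A i.
pose g i := - (U^T *m M *m V) i i.
have form c : ip (measure_map A (spec w)) (measure_map A (spec c)) =
    - \sum_i c 0 i * g i.
  rewrite measure_map_adjoint ip_diag -sumrN.
  by apply: eq_bigr => i _; rewrite mulrN opprK.
have [J [JS JL Jg]] := sparse_dominates g a0 va vS vL.
(* The sign makes <A w, A d> an upper bound of - <A w, A v>. *)
pose d : 'rV[R]_n1 := \row_i (if i \in J then - a else 0).
have disj i : i \in J -> i \notin S1 by move/(fintype.subsetP JS); rewrite inE.
have wd0 i : w 0 i * d 0 i = 0.
  by rewrite !mxE; case: (boolP (i \in J)) => [/disj/negbTE->|_]; rewrite (mul0r, mulr0).
have card_S : (#|S1 :|: J| <= N)%N.
  rewrite (leq_trans (leq_card_setU _ _))// (leq_trans (leq_add (leq_card_setU _ _) JL))//.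
  by rewrite /L -addnA subnKC// (leq_trans (leq_add topk (leqnn _)))// subnKC// ltnW.
have supp i : i \notin S1 :|: J -> w 0 i = 0 /\ d 0 i = 0.
  by rewrite inE negb_or => /andP[/negbTE iS /negbTE iJ]; rewrite !mxE iS iJ.
pose Y := T ^+ 2 / q%:R.
have dY : \sum_i d 0 i ^+ 2 <= Y.
  have -> : \sum_i d 0 i ^+ 2 = #|J|%:R * a ^+ 2.
    rewrite mulr_natl -sumr_const [RHS]big_mkcond; apply: eq_bigr => i _; rewrite mxE.
    by case: ifP; rewrite ?sqrrN ?expr0n.
  have -> : Y = q%:R * a ^+ 2 by rewrite /Y Ta; field; rewrite gt_eqF.
  rewrite ler_wpM2r ?sqr_ge0// ler_nat (leq_trans JL)//; exact: leq_subr.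
have hE : h = w + \row_i v i.
  by apply/rowP => i; rewrite !mxE /v; case: ifP; rewrite ?addr0 ?add0r.
set P := l2norm _; have P0 : 0 <= P by exact: sqrtr_ge0.
set p := ip (measure_map A (spec w)) (measure_map A (spec w)).
pose e := ip (measure_map A (spec w)) (measure_map A (spec d)).
have p_le : p <= Num.sqrt p * P + e.
  have := CauchySchwarz_ip (measure_map A (spec w)) (measure_map A (spec h)).
  rewrite -(l2normE (measure_map A (spec h))) -/P -/p.
  rewrite {1}hE specD measure_mapD ipDr -/p form.
  have -> : e = a * \sum_(i in J) g i.
    rewrite /e form mulr_sumr -sumrN [RHS]big_mkcond; apply: eq_bigr => i _.
    by rewrite mxE; case: ifP => _; rewrite ?mulNr ?opprK ?mul0r ?oppr0.
  have -> : \sum_i (\row_i0 v i0) 0 i * g i = \sum_i v i * g i.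
    by apply: eq_bigr => i _; rewrite mxE.
  lra.
pose X := \sum_i w 0 i ^+ 2; pose x := Num.sqrt X.
have X0 : 0 <= X by apply: sumr_ge0 => i _; rewrite sqr_ge0.
have x_ge : Num.sqrt (\sum_(i < n1 | (i < k)%N) h 0 i ^+ 2) <= x.
  rewrite ler_wsqrtr// [leLHS]big_mkcond; apply: ler_sum => i _; rewrite !mxE !inE.
  by case: ifP => //=; rewrite sqr_ge0.
have pX : (1 - delta) * X <= p.
  by apply: (rip_spec _ card_S).1 => i /supp[].
have p0 : 0 <= p by exact: ip_ge0.
have sd0 : 0 < Num.sqrt (1 - delta) by rewrite sqrtr_gt0 subr_gt0.
pose y := T / Num.sqrt q%:R.
have sq0 : 0 < Num.sqrt (q%:R : R) by rewrite sqrtr_gt0.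
have y0 : 0 <= y by rewrite divr_ge0// ltW.
have yY : y ^+ 2 = Y by rewrite expr_div_n sqr_sqrtr// ltW.
have s20 : 0 < Num.sqrt (1 - delta ^+ 2).
  by rewrite sqrtr_gt0 subr_gt0 expr_lt1// ltW.
pose K := delta / Num.sqrt (1 - delta ^+ 2).
have K0 : 0 <= K by rewrite divr_ge0 ?ltW.
rewrite -/y -/K.
have [xK|xK] := leP x (K * y).
  apply: (le_trans _ P0); apply: mulr_ge0_le0; first exact: ltW.
  by rewrite subr_le0 (le_trans x_ge).
have x0 : 0 < x by rewrite (le_lt_trans _ xK)// mulr_ge0.
apply: (@le_trans _ _ (Num.sqrt (1 - delta) * (x - K * y))).
  by apply: ler_wpM2l; [exact: ltW|rewrite lerD2r].
have sp : Num.sqrt (1 - delta) * x <= Num.sqrt p.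
  by rewrite /x -sqrtrM; [exact: ler_wsqrtr|rewrite subr_ge0 ltW].
have sp0 : 0 < Num.sqrt p by rewrite (lt_le_trans _ sp)// mulr_gt0.
have ep : e * x <= K * y * p.
  have [T00|Tn] := eqVneq T 0.
    suff -> : e = 0 by rewrite mul0r; apply: mulr_ge0 => //; exact: mulr_ge0.
    have aa : a = 0 by rewrite /a T00 mul0r.
    by rewrite /e form big1 ?oppr0// => i _; rewrite mxE aa oppr0 if_same mul0r.
  have yn : 0 < y by rewrite divr_gt0// lt_def Tn.
  have := @rip_cross w d _ (Num.sqrt (1 - delta ^+ 2) * x / y) Y supp card_S wd0 dY.
  rewrite -yY expr_div_n exprMn /x !sqr_sqrtr//; last first.
    by rewrite subr_ge0 expr_le1// ltW.
  rewrite divfK; last by rewrite sqrf_eq0 gt_eqF.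
  move=> /(_ erefl); rewrite -/x -/e -/p => h1.
  have : Num.sqrt (1 - delta ^+ 2) / y * (e * x) <=
         Num.sqrt (1 - delta ^+ 2) / y * (K * y * p).
    rewrite (_ : _ * (K * y * p) = delta * p); first by move: h1; clear; lra.
    by rewrite /K; field; rewrite !gt_eqF.
  by rewrite ler_pM2l// divr_gt0.
have pE : p = Num.sqrt p ^+ 2 by rewrite sqr_sqrtr.
rewrite -(ler_pM2r x0) -(ler_pM2l sp0).
move: {p_le}(ler_wpM2r (ltW x0) p_le) ep sp sp0 xK pE; rewrite -[K * y < x]subr_gt0.
move: (Num.sqrt p) (Num.sqrt (1 - delta)) => r sd h1 h2 h3 r0 h4 pE.
have h5 : 0 <= (r - sd * x) * (x - K * y) * r.
  by apply: mulr_ge0 (ltW r0); apply: mulr_ge0 (ltW h4); rewrite subr_ge0.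
move: h1 h2 h5; rewrite pE; clear; lra.
Qed.

End NullSpace.

(** * Error bounds *)

Section Estimates.
Context {R : realType}.

Lemma sum_top_le n k (h : 'rV[R]_n) : (k <= n)%N ->
  \sum_(i < n | (i < k)%N) h 0 i <=
  Num.sqrt k%:R * Num.sqrt (\sum_(i < n | (i < k)%N) h 0 i ^+ 2).
Proof.
move=> kn; pose c : 'rV[R]_n := \row_i (if (i < k)%N then 1 else 0).
pose d : 'rV[R]_n := \row_i (if (i < k)%N then h 0 i else 0).
have := CauchySchwarz_ip c d; rewrite !ipE !big_ord1.
have -> : \sum_j c 0 j * d 0 j = \sum_(i < n | (i < k)%N) h 0 i.
  by rewrite [RHS]big_mkcond; apply: eq_bigr => i _; rewrite !mxE; case: ifP; rewrite ?mul1r ?mul0r.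
have -> : \sum_j c 0 j * c 0 j = k%:R.
  transitivity (\sum_(i < n | (i < k)%N) (1 : R)).
    by rewrite [RHS]big_mkcond; apply: eq_bigr => i _; rewrite !mxE; case: ifP; rewrite ?mul1r ?mul0r.
  by rewrite -(big_ord_widen _ (fun=> 1 : R) kn) sumr_const card_ord.
suff -> : \sum_j d 0 j * d 0 j = \sum_(i < n | (i < k)%N) h 0 i ^+ 2 by [].
by rewrite [RHS]big_mkcond; apply: eq_bigr => i _; rewrite !mxE; case: ifP; rewrite ?mul0r.
Qed.

(** Write x for the l2 norm of the k leading entries and tau = T / sqrt k.  The
    squares of the others sum to at most h_k T <= x tau, and
    x^2 + x tau <= (x + tau / 2)^2. *)
Lemma sqrt_sum_le n k (h : 'rV[R]_n) : (0 < k)%N -> (k < n)%N ->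
  (forall i, 0 <= h 0 i) -> (forall i j : 'I_n, (i <= j)%N -> h 0 j <= h 0 i) ->
  Num.sqrt (\sum_i h 0 i ^+ 2) <=
  Num.sqrt (\sum_(i < n | (i < k)%N) h 0 i ^+ 2) +
  (\sum_(i < n | ~~ (i < k)%N) h 0 i) / Num.sqrt k%:R / 2.
Proof.
move=> k0 kn h0 hdec; pose a := h 0 (Ordinal kn).
have a0 : 0 <= a by exact: h0.
have sk0 : 0 < Num.sqrt (k%:R : R) by rewrite sqrtr_gt0 ltr0n.
rewrite [X in Num.sqrt X <= _](bigID (fun i : 'I_n => (i < k)%N)) /=.
set X := \sum_(i < n | (i < k)%N) _; set Y := \sum_(i < n | ~~ _) _ ^+ 2.
set T := \sum_(i < n | ~~ _) _.
have T0 : 0 <= T by apply: sumr_ge0.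
have YT : Y <= a * T.
  rewrite mulr_sumr; apply: ler_sum => i; rewrite -leqNgt => ki.
  by rewrite expr2 ler_wpM2r//; exact: hdec.
have X0 : 0 <= X by apply: sumr_ge0 => i _; rewrite sqr_ge0.
have kaX : k%:R * a ^+ 2 <= X.
  have -> : k%:R * a ^+ 2 = \sum_(i < n | (i < k)%N) a ^+ 2.
    by rewrite -(big_ord_widen _ (fun=> a ^+ 2) (ltnW kn)) sumr_const card_ord mulr_natl.
  by apply: ler_sum => i ik; rewrite ler_pXn2r ?nnegrE//; apply: hdec; exact: ltnW.
have ax : Num.sqrt k%:R * a <= Num.sqrt X.
  rewrite -[a]ger0_norm// -sqrtr_sqr -sqrtrM ?ler0n//; exact: ler_wsqrtr.
have aT : a * T <= Num.sqrt X * (T / Num.sqrt k%:R).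
  by rewrite mulrA ler_pdivlMr// mulrAC (mulrC a) ler_wpM2r.
move: (T / Num.sqrt k%:R) aT (divr_ge0 T0 (ltW sk0)) => tau aT tau0.
have r0 := sqrtr_ge0 X.
have S0 : 0 <= Num.sqrt X + tau / 2 by lra.
rewrite -[leRHS]ger0_norm// -sqrtr_sqr; apply: ler_wsqrtr.
have := sqr_sqrtr X0; move: (Num.sqrt X) aT r0 => r aT r0 rX.
by have := sqr_ge0 tau; nra.
Qed.

(** With c = sk b1 lambda + eps the hypotheses give
    P^2 - 2 c P + 2 lambda (1 - b2) T <= 4 lambda rho.  Dropping T bounds P, and
    dropping P^2 bounds (1 - b2) T by 2 rho + c P / lambda; substituting both in
    F <= b1 P + (b2 + 1/2) T / sk yields constants below the stated ones.  The
    ratios r = rho / c and cl = c / lambda make the comparison linear. *)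
Lemma error_bounds (b1 b2 sk lambda eps rho P T Tk x F : R) :
  0 < b1 -> 0 <= b2 < 1 -> 0 < sk -> 0 < lambda -> 0 <= eps -> 0 <= rho ->
  0 <= P -> 0 <= T ->
  P ^+ 2 - 2 * eps * P <= 2 * lambda * (2 * rho + Tk - T) ->
  Tk <= sk * x -> x <= b1 * P + b2 * (T / sk) -> F <= x + T / sk / 2 ->
  P <= 2 * lambda / (sk * b1 * lambda + eps) * rho + 2 * (sk * b1 * lambda + eps) /\
  F <= (2 * sk * b1 * (3 + 3 * b2 + b2 ^+ 2) * lambda
              + 2 * (1 + 4 * b2 + 2 * b2 ^+ 2) * eps)
            / (sk * (1 - b2) * (sk * b1 * lambda + eps)) * rho +
   (sk * b1 * (5 + 2 * b2) * lambda
              + (1 + 4 * b2 + 2 * b2 ^+ 2) * eps)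
            / (sk * (1 - b2) * lambda) * (sk * b1 * lambda + eps).
Proof.
move=> b10 /andP[b20 b21] sk0 l0 e0 rho0 P0 T0 opt hTk hx hF.
pose b := sk * b1 * lambda; pose c := b + eps.
have b0 : 0 < b by rewrite !mulr_gt0.
have c0 : 0 < c by rewrite ltr_wpDr.
have {hTk} hTk : Tk <= sk * b1 * P + b2 * T.
  apply: (le_trans hTk).
  rewrite (_ : _ + _ = sk * (b1 * P + b2 * (T / sk))); first by rewrite ler_pM2l.
  by field; rewrite gt_eqF.
have hT : P ^+ 2 - 2 * c * P <= 4 * (lambda * rho) - 2 * (lambda * ((1 - b2) * T)).
  have : lambda * Tk <= lambda * (sk * b1 * P + b2 * T) by rewrite ler_pM2l.
  by move: opt; rewrite /c /b; clear; lra.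
pose r := rho / c; have r0 : 0 <= r by rewrite divr_ge0// ltW.
have rE : rho = r * c by rewrite /r divfK// gt_eqF.
have hP : P <= 2 * (lambda * r) + 2 * c.
  rewrite leNgt; apply/negP => hlt.
  have lr : 0 <= lambda * r by rewrite mulr_ge0// ltW.
  have bT : 0 <= lambda * ((1 - b2) * T).
    by rewrite mulr_ge0 ?(ltW l0)// mulr_ge0// subr_ge0 ltW.
  move: hT; rewrite rE (mulrA lambda); move: (lambda * r) lr hlt => z lr hlt hT.
  have : 0 < (P - 2 * c - 2 * z) * P by rewrite mulr_gt0//; lra.
  have : 0 <= z * (P - 2 * c) by rewrite mulr_ge0//; lra.
  by move: hT bT; clear; nra.
split.
  apply: (le_trans hP); rewrite -/b -/c le_eqVlt; apply/orP; left; apply/eqP.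
  by rewrite /r; field; rewrite gt_eqF.
pose cl := c / lambda; have cl0 : 0 < cl by rewrite divr_gt0.
have clE : c = cl * lambda by rewrite /cl divfK// gt_eqF.
have h1b : 0 < 1 - b2 by rewrite subr_gt0.
have hT2 : (1 - b2) * T <= c * (4 * r + 2 * cl).
  rewrite -(ler_pM2l l0).
  have : c * P <= c * (2 * (lambda * r) + 2 * c) by rewrite ler_pM2l.
  rewrite [in X in _ <= X -> _]clE.
  have := sqr_ge0 P; move: hT; rewrite rE clE; clear; nra.
have hP2 : b1 * P * sk <= b * (2 * r + 2 * cl).
  have -> : b * (2 * r + 2 * cl) = b1 * (2 * (lambda * r) + 2 * c) * sk.
    by rewrite clE /b; ring.
  by rewrite ler_pM2r// ler_pM2l.
have hF2 : F * (sk * (1 - b2)) <=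
    (1 - b2) * (b * (2 * r + 2 * cl)) + (b2 + 1 / 2) * (c * (4 * r + 2 * cl)).
  have d0 : 0 < sk * (1 - b2) by rewrite mulr_gt0.
  have hF' : F <= b1 * P + (b2 + 1 / 2) * (T / sk) by lra.
  apply: (@le_trans _ _ ((b1 * P + (b2 + 1 / 2) * (T / sk)) * (sk * (1 - b2)))).
    by rewrite ler_pM2r.
  have -> : (b1 * P + (b2 + 1 / 2) * (T / sk)) * (sk * (1 - b2)) =
      (1 - b2) * (b1 * P * sk) + (b2 + 1 / 2) * ((1 - b2) * T).
    by field; rewrite gt_eqF.
  apply: lerD; first by rewrite ler_pM2l.
  by rewrite ler_pM2l//; lra.
set G := (X in _ <= X).
have -> : G = ((2 * b * (3 + 3 * b2 + b2 ^+ 2) + 2 * (1 + 4 * b2 + 2 * b2 ^+ 2) * eps) * r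
   + (b * (5 + 2 * b2) + (1 + 4 * b2 + 2 * b2 ^+ 2) * eps) * cl) / (sk * (1 - b2)).
  rewrite /G -/b -/c /r /cl.
  rewrite (_ : 2 * sk * b1 * (3 + 3 * b2 + b2 ^+ 2) * lambda =
               2 * b * (3 + 3 * b2 + b2 ^+ 2)); last by rewrite /b; ring.
  rewrite (_ : sk * b1 * (5 + 2 * b2) * lambda = b * (5 + 2 * b2)); last by rewrite /b; ring.
  by move: b c c0 {G hT hP hT2 hP2 hF2 b0 r cl r0 rE cl0 clE} => b c c0;
    field; rewrite !gt_eqF.
rewrite ler_pdivlMr ?mulr_gt0//; apply: (le_trans hF2).
have b2sq := sqr_ge0 b2.
have hr : 2 * (1 - b2) * b + (4 * b2 + 2) * c <=
    2 * b * (3 + 3 * b2 + b2 ^+ 2) + 2 * (1 + 4 * b2 + 2 * b2 ^+ 2) * eps.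
  by rewrite /c; nra.
have hc : 2 * (1 - b2) * b + (2 * b2 + 1) * c <=
    b * (5 + 2 * b2) + (1 + 4 * b2 + 2 * b2 ^+ 2) * eps.
  by rewrite /c; nra.
have := ler_wpM2r r0 hr; have := ler_wpM2r (ltW cl0) hc.
by clear; lra.
Qed.

End Estimates.

Theorem theorem3p1 (R : realType) (n1 n2 m k : nat) (t lambda eps delta : R)
    (A : 'I_m -> 'M[R]_(n1, n2))
    (hn : (n1 <= n2)%N) (ht : 1 < t) (hk : (0 < k)%N) (hkn : (k < n1)%N)
    (htk : t * k%:R < n1%:R) (hlambda : 0 < lambda) (heps : 0 <= eps)
    (hric : is_ric_real A (t * k%:R) delta)
    (hdelta : delta < Num.sqrt ((t - 1) / t)) :
  let beta1 := 2 / ((1 - delta) * Num.sqrt (1 + delta)) in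
  let beta2 := delta / Num.sqrt ((1 - delta ^+ 2) * (t - 1)) in
  let sk := Num.sqrt (k%:R : R) in
  let C1 := 2 * lambda / (sk * beta1 * lambda + eps) in
  let C2 := 2 * (sk * beta1 * lambda + eps) in
  let C3 := (2 * sk * beta1 * (3 + 3 * beta2 + beta2 ^+ 2) * lambda
              + 2 * (1 + 4 * beta2 + 2 * beta2 ^+ 2) * eps)
            / (sk * (1 - beta2) * (sk * beta1 * lambda + eps)) in
  let C4 := (sk * beta1 * (5 + 2 * beta2) * lambda
              + (1 + 4 * beta2 + 2 * beta2 ^+ 2) * eps)
            / (sk * (1 - beta2) * lambda) * (sk * beta1 * lambda + eps) in
  forall (X : 'M[R]_(n1, n2)) (s : 'rV[R]_n1) (U : 'M[R]_n1)
    (V : 'M[R]_(n2, n1)) (e : 'cV[R]_m) (Xs : 'M[R]_(n1, n2)),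
  is_svd X s U V ->
  l2norm e <= eps ->
  is_optimal A lambda (measure_map A X + e) Xs ->
  l2norm (measure_map A (Xs - X)) <= C1 * nuclear (X - svd_trunc k s U V) + C2
  /\ frobenius (Xs - X) <= C3 * nuclear (X - svd_trunc k s U V) + C4.
Proof.
move=> beta1 beta2 sk C1 C2 C3 C4 X s U V e Xs sX he hopt.
have [d01 rip _] := hric; have /andP[d0 d1] := d01.
have t10 : 0 < t - 1 by rewrite subr_gt0.
have t0 : 0 < t by rewrite (lt_trans _ ht).
have k0 : 0 < k%:R :> R by rewrite ltr0n.
set N := `|Num.ceil (t * k%:R)|%N in rip.
have tkN : t * k%:R <= N%:R.
  have tk0 : 0 <= Num.ceil (t * k%:R).
    by rewrite -(ler_int R) (le_trans _ (ceil_ge _))// mulr_ge0// ltW.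
  by rewrite -[N%:R]/(N%:Z%:~R) /N gez0_abs// ceil_ge.
have kN : (k < N)%N.
  by rewrite -(ltr_nat R) (lt_le_trans _ tkN)// ltr_pMl.
have [h [UH [VH sH]]] := svd_exists (Xs - X) hn.
have [UUH VVH h0 hdec _] := sH; have [UU VV s0 _ _] := sX.
have HE := is_svdE sH; set H := Xs - X in HE sH *.
have nsp := robust_nsp UUH VVH rip d01 kN h0; rewrite -HE in nsp.
have sk0 : 0 < sk by rewrite sqrtr_gt0.
have sd0 : 0 < Num.sqrt (1 - delta) by rewrite sqrtr_gt0 subr_gt0.
have se0 : 0 < Num.sqrt (1 + delta) by rewrite sqrtr_gt0 addr_gt0.
have d20 : 0 < 1 - delta ^+ 2 by rewrite subr_gt0 expr_lt1// ltW.
have b10 : 0 < beta1 by rewrite divr_gt0// mulr_gt0// subr_gt0.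
have b2s0 : 0 < Num.sqrt ((1 - delta ^+ 2) * (t - 1)) by rewrite sqrtr_gt0 mulr_gt0.
have b20 : 0 <= beta2 by rewrite divr_ge0 ?(ltW d0)// ltW.
(* beta2 < 1 amounts to delta^2 t < t - 1. *)
have b21 : beta2 < 1.
  have dt : delta ^+ 2 * t < t - 1.
    rewrite -ltr_pdivlMr// -(@sqr_sqrtr _ ((t - 1) / t)) ?divr_ge0 ?(ltW t10) ?(ltW t0)//.
    by rewrite ltr_pXn2r// nnegrE ?(ltW d0)// sqrtr_ge0.
  rewrite ltr_pdivrMr// mul1r -[ltLHS]ger0_norm ?(ltW d0)// -sqrtr_sqr.
  by rewrite ltr_sqrt ?mulr_gt0//; lra.
have topH := sum_top_le h (ltnW hkn).
have froH : frobenius H = Num.sqrt (\sum_i h 0 i ^+ 2).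
  by rewrite frobeniusE HE ip_spec.
have nucXs := nuclear_add_ge hn hkn sX sH.
have nucX := nuclear_svd sX; rewrite (bigID (fun i : 'I_n1 => (i < k)%N)) /= in nucX.
(* U V^T takes the value 1 on every singular pair of X, hence on the tail. *)
have rho_ge : \sum_(i < n1 | ~~ (i < k)%N) s 0 i <= nuclear (X - svd_trunc k s U V).
  apply: (le_trans _ (nuclear_ge _ hn (polar_coisometry UU VV))).
  rewrite ipBr svd_truncE (is_svdE sX) !(ip_polar UU VV).
  rewrite [X in _ <= X - _](bigID (fun i : 'I_n1 => (i < k)%N)) /=.
  rewrite [X in _ <= _ - X](_ : _ = \sum_(i < n1 | (i < k)%N) s 0 i).
    by rewrite addrAC subrr add0r.
  by rewrite [RHS]big_mkcond; apply: eq_bigr => i _; rewrite mxE.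
have opt := hopt X; rewrite /objective in opt.
have XH : X + H = Xs by rewrite /H addrC subrK.
rewrite XH in nucXs.
have res1 : measure_map A X + e - measure_map A Xs = e - measure_map A H.
  by rewrite /H measure_mapB opprB addrA (addrC e).
have res2 : measure_map A X + e - measure_map A X = e by rewrite addrAC subrr add0r.
rewrite res1 res2 !l2norm_sqr !(ipBl, ipBr) (ipC _ e) in opt.
have eP : ip e (measure_map A H) <= eps * l2norm (measure_map A H).
  by rewrite (le_trans (CauchySchwarz_ip _ _))// -!l2normE ler_wpM2r// sqrtr_ge0.
have P2 := l2norm_sqr (measure_map A H).
apply: (@error_bounds R beta1 beta2 sk lambda eps _ _
  (\sum_(i < n1 | ~~ (i < k)%N) h 0 i) (\sum_(i < n1 | (i < k)%N) h 0 i)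
  (Num.sqrt (\sum_(i < n1 | (i < k)%N) h 0 i ^+ 2))) => //.
- by rewrite b20.
- by rewrite (le_trans _ rho_ge)// sumr_ge0.
- exact: sqrtr_ge0.
- by rewrite sumr_ge0.
- have l20 : 0 < 2 * lambda by rewrite mulr_gt0.
  rewrite P2 -ler_pdivrMl//.
  set y := ip e (measure_map A H) in opt eP; set p := ip (measure_map A H) _ in opt *.
  set ee := ip e e in opt.
  have : (2 * lambda)^-1 * (p - 2 * eps * l2norm (measure_map A H)) <=
         (2 * lambda)^-1 * (p - 2 * y).
    by rewrite ler_pM2l ?invr_gt0//; lra.
  move: opt nucXs; rewrite nucX; move: rho_ge; clear; lra.
(* N / k >= t, so the constant obtained for N is at most [beta2]. *)
- have qk : (t - 1) * k%:R <= (N - k)%:R by rewrite natrB ?(ltnW kN)//; lra.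
  set T := \sum_(i < n1 | ~~ (i < k)%N) h 0 i in nsp *.
  have T0 : 0 <= T by rewrite sumr_ge0.
  have q0 : 0 < Num.sqrt ((N - k)%:R : R) by rewrite sqrtr_gt0 ltr0n subn_gt0.
  have hK : delta / Num.sqrt (1 - delta ^+ 2) * (T / Num.sqrt (N - k)%:R) <=
      beta2 * (T / sk).
    have sqk : Num.sqrt (t - 1) * sk <= Num.sqrt (N - k)%:R.
      by rewrite -sqrtrM; [exact: ler_wsqrtr|exact: ltW].
    have st0 : 0 < Num.sqrt (t - 1) by rewrite sqrtr_gt0.
    have sd20 : 0 < Num.sqrt (1 - delta ^+ 2) by rewrite sqrtr_gt0.
    have -> : beta2 * (T / sk) =
        delta / Num.sqrt (1 - delta ^+ 2) * (T / (Num.sqrt (t - 1) * sk)).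
      rewrite /beta2 sqrtrM ?(ltW d20)//; field.
      by rewrite !gt_eqF.
    rewrite ler_wpM2l ?divr_ge0 ?(ltW d0) ?(ltW sd20)//.
    by rewrite ler_wpM2l// lef_pV2// posrE mulr_gt0.
  have b1d : 1 <= beta1 * Num.sqrt (1 - delta).
    have e1 : 1 - delta = Num.sqrt (1 - delta) ^+ 2 by rewrite sqr_sqrtr// subr_ge0 ltW.
    have e2 : Num.sqrt (1 - delta) * Num.sqrt (1 + delta) <= 2.
      rewrite -sqrtrM ?subr_ge0 ?(ltW d1)//.
      rewrite (@le_trans _ _ (Num.sqrt 1))//; last by rewrite sqrtr1; lra.
      by apply: ler_wsqrtr; have := sqr_ge0 delta; lra.
    rewrite /beta1 {1}e1.
    rewrite (_ : _ / _ * _ = 2 / (Num.sqrt (1 - delta) * Num.sqrt (1 + delta))).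
      by rewrite ler_pdivlMr ?mul1r// mulr_gt0.
    by field; rewrite !gt_eqF.
  move: nsp; set x := Num.sqrt (\sum_(i < n1 | _) _).
  set P := l2norm _; set K := delta / _ * (T / _) in hK * => nsp.
  have P0 : 0 <= P by exact: sqrtr_ge0.
  have h1 : x - K <= beta1 * P.
    apply: (@le_trans _ _ (P / Num.sqrt (1 - delta))).
      by rewrite ler_pdivlMr// [leLHS]mulrC.
    by rewrite ler_pdivrMr// -mulrA [P * _]mulrC mulrA ler_peMl.
  by move: h1 hK; clear; lra.
- by rewrite froH; exact: sqrt_sum_le.
Qed.
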